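(* Let $l\ge 1$ and let $A$ be an $l\times l$ Jordan block over $\mathbb{C}$ with eigenvalue $\lambda$, acting on $\mathbb{C}^l$. Let $L(x)$ denote the limit set of $x$ under $A$. (i) If $|\lambda|=1$ and $x=(x_1,\ldots,x_l)\in\mathbb{C}^l$, then $L(x)\neq\emptyset$ if and only if $x_2=\cdots=x_l=0$. In this case $L(x)=\{d\,x_1: d\in D\}\times\{0\}^{l-1}$, where $D$ is the closure of the set $\{\lambda^n : n \text{ a positive integer}\}$ in $\mathbb{C}$. (ii) If $|\lambda|>1$, then $L(x)=\emptyset$ for every non-zero vector $x\in\mathbb{C}^l$. (iii) If $|\lambda|<1$, then $L(x)=\{0\}$ for every $x\in\mathbb{C}^l$.
   Context: An $l\times l$ Jordan block with eigenvalue $\lambda$ is the matrix with all main diagonal entries equal to $\lambda$, all entries on the diagonal just above the main diagonal equal to $1$, and all other entries $0$. The limit set of $x\in\mathbb{C}^l$ under $A$ is $L(x)=\{y\in\mathbb{C}^l:$ there exists a strictly increasing sequence of positive integers $\{k_n\}$ such that $A^{k_n}x\to y\}$. *)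

(* Defs.v *)
From mathcomp Require Import all_boot all_order all_algebra.
From mathcomp Require Export complex.
From mathcomp Require Import all_classical all_reals all_analysis.

Set Implicit Arguments.
Unset Strict Implicit.
Unset Printing Implicit Defensive.

Import Order.TTheory GRing.Theory Num.Theory.
Import numFieldNormedType.Exports.

Local Open Scope classical_set_scope.
Local Open Scope ring_scope.

Definition jordan_block (K : numFieldType) (l : nat) (lambda : K) : 'M[K]_l :=
  \matrix_(i, j) (if i == j then lambda else if j == i.+1 :> nat then 1 else 0).

(* Convergence in 'cV[K]_l is entrywise, for the topology of the norm on K. *)
Definition limit_set (K : numFieldType) (l : nat) (A : 'M[K]_l) (x : 'cV[K]_l) :
    set 'cV[K]_l :=
  [set y | exists k : nat -> nat,
    [/\ forall n, (0 < k n)%N,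
        {homo k : m n / (m < n)%N}
      & (fun n => A ^+ k n *m x) @ \oo --> y]].

(* Stated over a numFieldType K because R[i] itself has no declared topology:
   it is found only by seeing R[i] as an instance of numFieldType. *)
Definition closure_pos_powers (K : numFieldType) (lambda : K) : set K :=
  closure [set lambda ^+ n | n in [set n | (0 < n)%N]].

(* Main.v *)
Require Import Defs.
From mathcomp Require Import all_boot all_order all_algebra.
From mathcomp Require Import complex ring lra.
From mathcomp Require Import all_classical all_reals all_analysis.

(** Write A for the Jordan block with eigenvalue z.  Its superdiagonal couples
    each coordinate only to the next one, so the orbit of x can be read from the
    bottom up.  Divergence is visible on two explicit coordinates: if x_m is
    the last non-zero coordinate of x, then coordinate m of [A^n x] is
    [z^n x_m] ([jordan_orbit_top]), and coordinate m - 1, when there is one, is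
    [z^n x_(m-1) + n z^(n-1) x_m] ([jordan_orbit_below_top], where both sides
    are multiplied by z).

    For |z| > 1 the first of these grows geometrically, and for |z| = 1 and
    m > 0 the second grows linearly; both growths persist along every
    subsequence, so no subsequence of the orbit converges
    ([limit_set_expanding], [limit_set_unimodular_support]).

    For |z| < 1, each coordinate obeys [u_(n+1) = z u_n + v_n], where v is the
    next coordinate; such a recurrence sends v -> 0 to u -> 0
    ([cvg0_affine_recurrence]), so by descending induction the whole orbit tends
    to 0 ([limit_set_contracting]).

    For |z| = 1 and x supported on its first coordinate, the orbit is
    [z^n x_0], and the limit set consists of the d x_0 with d a limit of powers
    of z along increasing exponents.  Such a d lies in the closure D.
    Conversely a point of D might only be a power z^n, approached for a single
    exponent; this is repaired by recurrence.  The powers of z stay in a compact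
    set, so two of them with distant exponents are close, and dividing them
    gives arbitrarily large q with z^q close to 1 ([unimodular_recurrence]);
    then z^(n+q) is close to z^n ([closure_pos_powers_frequently],
    [limit_set_unimodular]).

    Only the recurrence depends on the topology of the plane; the rest holds
    over any numeric field in which every norm is below some natural number. *)

Set Implicit Arguments.
Unset Strict Implicit.
Unset Printing Implicit Defensive.

Import Order.TTheory GRing.Theory Num.Theory.
Import numFieldNormedType.Exports.

Local Open Scope classical_set_scope.
Local Open Scope ring_scope.
Local Open Scope complex_scope.

(** * Convergence of sequences and limit sets *)

Lemma cvg_mxP (K : numFieldType) (T : Type) (F : set_system T) (m n : nat)
    (f : T -> 'M[K]_(m, n)) (y : 'M[K]_(m, n)) : Filter F ->
  f @ F --> y <-> forall i j, (fun t => f t i j) @ F --> y i j.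
Proof.
move=> FF; split=> [fy i j | fy].
  apply: (@cvg_comp _ _ _ f (fun M : 'M[K]_(m, n) => M i j) _ _ _ fy).
  exact: coord_continuous.
apply/cvg_ballP => e e0.
have : \forall t \near F, forall i j, ball (y i j) e (f t i j).
  apply: filter_forall => i; apply: filter_forall => j.
  by move/cvg_ballP : (fy i j); apply.
by apply: filterS => t yft; split.
Qed.

Lemma limit_setP (K : numFieldType) (l : nat) (A : 'M[K]_l) (x y : 'cV[K]_l) :
  limit_set A x y <-> exists k : nat -> nat,
    [/\ forall n, (0 < k n)%N,
        {homo k : m n / (m < n)%N}
      & forall i, (fun n => (A ^+ k n *m x) i ord0) @ \oo --> y i ord0].
Proof.
split=> -[k [k0 kh kl]]; exists k; split=> //.
  by move=> i; move/cvg_mxP : kl; apply.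
by apply/cvg_mxP => i j; rewrite ord1; apply: kl.
Qed.

(** The bounds M range over real elements because in a field such as the
    complex numbers only these are comparable with a norm. *)
Lemma unbounded_not_cvg (K : numFieldType) (u : nat -> K) (y : K) :
  u @ \oo --> y -> (forall M : K, M \is Num.real ->
    exists N, forall n, (N <= n)%N -> M <= `|u n|) -> False.
Proof.
move=> uy /(_ (`|y| + 1)); rewrite rpredD ?normr_real ?real1 //.
move=> /(_ isT) [N uN].
move/cvgrPdist_lt : uy => /(_ 1 ltr01) [N' _ uN'].
have := uN (maxn N N') (leq_maxl _ _).
have := uN' (maxn N N') (leq_maxr _ _) => /= u1 u2.
have : `|y| + 1 < `|y| + 1.
  apply: le_lt_trans u2 _.
  rewrite -{1}(subrK y (u _)) addrC; apply: le_lt_trans (ler_normD _ _) _.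
  by rewrite ltrD2l distrC.
by rewrite ltxx.
Qed.

Lemma leq_id_homo_ltn (k : nat -> nat) n :
  {homo k : m n / (m < n)%N} -> (n <= k n)%N.
Proof.
by move=> kh; elim: n => // n IH; apply: leq_ltn_trans IH _; apply: kh.
Qed.

(** Successive exponents are chosen beyond the previous one and within 1/(n+1)
    of the target, whence the Archimedean hypothesis. *)
Lemma frequently_cvg_subseq (K : numFieldType) (u : nat -> K) (y : K) :
  Num.archimedean_axiom K ->
  (forall (e : K) N, 0 < e -> exists2 n, (N <= n)%N & `|y - u n| < e) ->
  exists k : nat -> nat, [/\ forall n, (0 < k n)%N,
    {homo k : m n / (m < n)%N} & u \o k @ \oo --> y].
Proof.
move=> aK uy.
have /choice[f fP] (p : nat * nat) :
    exists n, (p.1 < n)%N /\ `|y - u n| < p.2.+1%:R^-1.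
  have [|n pn un] := uy p.2.+1%:R^-1 p.1.+1; first by rewrite invr_gt0.
  by exists n.
pose k := fix k n := f (if n is m.+1 then k m else 0%N, n).
have kE n : `|y - u (k n)| < n.+1%:R^-1.
  by case: n => [|n]; [exact: (fP (0%N, 0%N)).2 | exact: (fP (k n, n.+1)).2].
exists k; split.
- by case=> [|n]; [exact: (fP (0%N, 0%N)).1 | exact: leq_ltn_trans (fP (k n, n.+1)).1].
- by apply: homo_ltn; [exact: ltn_trans | move=> n; exact: (fP (k n, n.+1)).1].
apply/cvgrPdist_lt => e e0; have [N eN] := aK e^-1.
exists N => // n /= Nn; apply: lt_trans (kE n) _.
rewrite invf_plt ?posrE //; apply: le_lt_trans (real_ler_norm _) _.
  by rewrite realV gtr0_real.
by apply: lt_le_trans eN _; rewrite ler_nat; apply: leq_trans Nn _.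
Qed.

(** * Growth and decay of powers *)

(** Bernoulli's inequality. *)
Lemma expr_ge_linear (K : numDomainType) (z : K) n :
  1 <= z -> 1 + (z - 1) *+ n <= z ^+ n.
Proof.
move=> z1; elim: n => [|n IH]; first by rewrite mulr0n addr0 expr0.
rewrite exprS; apply: le_trans (ler_wpM2l (le_trans ler01 z1) IH).
rewrite -subr_ge0 -!(mulr_natr (z - 1)) -natr1.
have -> : z * (1 + (z - 1) * n%:R) - (1 + (z - 1) * (n%:R + 1)) =
  (z - 1) * (z - 1) * n%:R by ring.
by rewrite !mulr_ge0 // subr_ge0.
Qed.

Lemma archimedean_expr_gt (K : numFieldType) (z M : K) :
  Num.archimedean_axiom K -> 1 < z -> M \is Num.real ->
  exists N, forall n, (N <= n)%N -> M < z ^+ n.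
Proof.
move=> aK z1 Mr; have z10 : 0 < z - 1 by rewrite subr_gt0.
have [N MN] := aK (M / (z - 1)); exists N => n Nn.
apply: lt_le_trans (expr_ge_linear n (ltW z1)).
apply: le_lt_trans (real_ler_norm Mr) _.
apply: (@lt_le_trans _ _ ((z - 1) *+ N)).
  by move: MN; rewrite normrM normfV (gtr0_norm z10) ltr_pdivrMr // mulr_natl.
apply: (@le_trans _ _ ((z - 1) *+ n)); last by rewrite lerDr.
by apply: ler_wpMn2l Nn; exact: ltW.
Qed.

Lemma archimedean_expr_lt (K : numFieldType) (z e : K) :
  Num.archimedean_axiom K -> 0 <= z < 1 -> 0 < e ->
  exists N, forall n, (N <= n)%N -> z ^+ n < e.
Proof.
move=> aK /andP[z0 z1] e0; have [->|zn0] := eqVneq z 0.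
  by exists 1%N => -[//|n] _; rewrite expr0n.
have {}z0 : 0 < z by rewrite lt_def zn0.
have [||N zN] := @archimedean_expr_gt _ z^-1 e^-1 aK.
- by rewrite invf_gt1.
- by rewrite realV gtr0_real.
exists N => n /zN; rewrite exprVn ltf_pV2 // posrE exprn_gt0 //.
Qed.

(** Once |v| stays below [(e/2) (1 - |z|)], the value e/2 is a fixed point of the
    majorizing recurrence, so the excess of |u| over e/2 shrinks by a factor |z|
    at each step. *)
Lemma cvg0_affine_recurrence (K : numFieldType) (z : K) (u v : nat -> K) :
  Num.archimedean_axiom K -> `|z| < 1 ->
  (forall n, u n.+1 = z * u n + v n) -> v @ \oo --> 0 -> u @ \oo --> 0.
Proof.
move=> aK z1 uS v0; apply/cvgrPdist_lt => e e0.
have e20 : 0 < e / 2 by rewrite divr_gt0.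
have z10 : 0 < 1 - `|z| by rewrite subr_gt0.
move/cvgrPdist_lt : v0 => /(_ _ (mulr_gt0 e20 z10)) [N _ vN].
have uN m : `|u (N + m)%N| <= `|z| ^+ m * `|u N| + e / 2.
  elim: m => [|m IH]; first by rewrite addn0 expr0 mul1r lerDl ltW.
  rewrite addnS uS; apply: le_trans (ler_normD _ _) _; rewrite normrM.
  have := vN (N + m)%N (leq_addr _ _); rewrite /= sub0r normrN => /ltW vm.
  apply: le_trans (lerD (ler_wpM2l (normr_ge0 _) IH) vm) _.
  by rewrite exprS le_eqVlt; apply/orP; left; apply/eqP; ring.
have uN1 : 0 < `|u N| + 1 by rewrite ltr_wpDl.
have [||M zM] := @archimedean_expr_lt _ `|z| (e / 2 / (`|u N| + 1)) aK.
- by rewrite normr_ge0.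
- by rewrite divr_gt0.
exists (N + M)%N => // n /= NMn; rewrite sub0r normrN.
rewrite -(subnKC (leq_trans (leq_addr M N) NMn)).
apply: le_lt_trans (uN _) _; rewrite [ltRHS](splitr e) ltrD2r.
have := zM (n - N)%N; rewrite leq_subRL ?(leq_trans (leq_addr M N)) // => /(_ NMn).
rewrite ltr_pdivlMr //; apply: le_lt_trans.
by rewrite ler_wpM2l ?exprn_ge0 // lerDl.
Qed.

(** * Orbits of a Jordan block *)

(** The partial map [insub] sends the successor of the last index to [None]:
    the last coordinate has no successor to be coupled to. *)
Lemma jordan_block_mulE (K : numFieldType) (l : nat) (z : K) (x : 'cV[K]_l)
    (i : 'I_l) :
  (jordan_block l z *m x) i ord0 =
  z * x i ord0 + (if insub i.+1 is Some j then x j ord0 else 0).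
Proof.
rewrite mxE (bigD1 i) //= mxE eqxx; congr (_ + _).
case: insubP => [j ji jE | il].
  rewrite (bigD1 j) /=; last first.
    by apply: contra_eq_neq jE => ->; rewrite ltn_eqF.
  rewrite mxE jE eqxx ifN; last by apply: contra_eq_neq jE => <-; rewrite ltn_eqF.
  rewrite mul1r big1 ?addr0 // => k /andP[ki kj]; rewrite mxE eq_sym (negPf ki).
  rewrite ifN ?mul0r //; apply: contraNneq kj => kE; apply/eqP/val_inj.
  exact: etrans kE (esym jE).
rewrite big1 // => k ki; rewrite mxE eq_sym (negPf ki) ifN ?mul0r //.
by apply: contraNneq il => <-.
Qed.

Section JordanOrbit.
Variables (K : numFieldType) (l : nat) (z : K) (x : 'cV[K]_l.+1).
Let A : 'M[K]_l.+1 := jordan_block l.+1 z.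

Lemma jordan_orbitS n (i : 'I_l.+1) :
  (A ^+ n.+1 *m x) i ord0 = z * (A ^+ n *m x) i ord0 +
    (if insub i.+1 is Some j then (A ^+ n *m x) j ord0 else 0).
Proof. by rewrite exprS -mulmxE -mulmxA jordan_block_mulE. Qed.

Lemma jordan_orbit_above (m : 'I_l.+1) n :
  (forall j : 'I_l.+1, (m < j)%N -> x j ord0 = 0) ->
  forall j : 'I_l.+1, (m < j)%N -> (A ^+ n *m x) j ord0 = 0.
Proof.
move=> xm; elim: n => [|n IH] j mj; first by rewrite expr0 mul1mx xm.
rewrite jordan_orbitS IH // mulr0 add0r; case: insubP => // k _ kE.
by rewrite IH // kE ltnW.
Qed.

Lemma jordan_orbit_top (m : 'I_l.+1) n :
  (forall j : 'I_l.+1, (m < j)%N -> x j ord0 = 0) ->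
  (A ^+ n *m x) m ord0 = z ^+ n * x m ord0.
Proof.
move=> xm; elim: n => [|n IH]; first by rewrite expr0 mul1mx mul1r.
rewrite jordan_orbitS IH exprS mulrA; case: insubP => [k _ kE|]; last by rewrite addr0.
by rewrite (jordan_orbit_above n xm) ?addr0 // kE.
Qed.

(** The factor z on the left clears the exponent n - 1 of the binomial term
    [n z^(n-1) x_m], so that the formula also makes sense for n = 0. *)
Lemma jordan_orbit_below_top (i m : 'I_l.+1) n :
  (forall j : 'I_l.+1, (m < j)%N -> x j ord0 = 0) -> m = i.+1 :> nat ->
  z * (A ^+ n *m x) i ord0 = z ^+ n * (z * x i ord0 + n%:R * x m ord0).
Proof.
move=> xm mi; elim: n => [|n IH]; first by rewrite expr0 !mul1mx mul0r addr0 mul1r.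
rewrite jordan_orbitS; case: insubP => [k _ kE|]; last by rewrite -mi ltn_ord.
rewrite (_ : k = m); last by apply: val_inj; exact: etrans kE (esym mi).
by rewrite (jordan_orbit_top n xm) mulrDr IH exprS -natr1; ring.
Qed.

Lemma last_nonzero_coord (i : 'I_l.+1) : x i ord0 != 0 ->
  exists m : 'I_l.+1, [/\ (i <= m)%N, x m ord0 != 0 &
    forall j : 'I_l.+1, (m < j)%N -> x j ord0 = 0].
Proof.
move=> xi; case: (@arg_maxnP _ i (fun j => x j ord0 != 0) (@nat_of_ord _) xi) => m xm mmax.
exists m; split=> //; first exact: mmax.
by move=> j; rewrite ltnNge; apply: contraNeq => /mmax.
Qed.

(** A non-zero coordinate of positive index provides a last non-zero one x_m
    with m > 0; the coordinate above it has norm at least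
    [n |x_m| - |x_(m-1)|]. *)
Lemma limit_set_unimodular_support (y : 'cV[K]_l.+1) :
  Num.archimedean_axiom K -> `|z| = 1 -> limit_set A x y ->
  forall i : 'I_l.+1, i != ord0 -> x i ord0 = 0.
Proof.
move=> aK z1 /limit_setP[k [_ kh ky]] i i0; apply: contrapT => /eqP xi0.
have [m [im xm0 xm]] := last_nonzero_coord xi0.
have m0 : (0 < m)%N by apply: leq_trans im; rewrite lt0n.
have m1 : (m.-1 < l.+1)%N by apply: leq_ltn_trans (ltn_ord m); exact: leq_pred.
pose j := Ordinal m1; have mj : m = j.+1 :> nat by rewrite /= prednK.
apply: (unbounded_not_cvg (ky j)) => M Mr.
have xm_gt0 : 0 < `|x m ord0| by rewrite normr_gt0.
have [N MN] := aK ((M + `|x j ord0|) / `|x m ord0|); exists N => n Nn.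
rewrite -[leRHS]mul1r -z1 -normrM (jordan_orbit_below_top _ xm mj).
rewrite normrM normrX z1 expr1n mul1r addrC -[z * x j ord0]opprK.
apply: le_trans (lerB_dist _ _); rewrite normrN !normrM z1 mul1r normr_nat lerBrDr.
have : M + `|x j ord0| <= N%:R * `|x m ord0|.
  rewrite -ler_pdivrMr //; apply: le_trans (ltW MN).
  by rewrite real_ler_norm // realM ?realV ?realD ?normr_real.
move/le_trans; apply; rewrite ler_wpM2r // ler_nat.
by apply: leq_trans Nn _; exact: leq_id_homo_ltn.
Qed.

Lemma limit_set_expanding :
  Num.archimedean_axiom K -> 1 < `|z| -> x != 0 -> limit_set A x = set0.
Proof.
move=> aK z1 x0; apply/seteqP; split=> // y /limit_setP[k [_ kh ky]].
have [i xi] : exists i, x i ord0 != 0.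
  apply: contrapT => /forallNP x_eq0; move/eqP: x0; apply.
  by apply/matrixP => i j; rewrite ord1 mxE; apply/eqP/negPn/negP/x_eq0.
have [m [_ xm0 xm]] := last_nonzero_coord xi.
apply: (unbounded_not_cvg (ky m)) => M Mr.
have xm_gt0 : 0 < `|x m ord0| by rewrite normr_gt0.
have [|N MN] := @archimedean_expr_gt _ `|z| (M / `|x m ord0|) aK z1.
  by rewrite realM ?realV ?normr_real.
exists N => n Nn; rewrite (jordan_orbit_top _ xm) normrM normrX -ler_pdivrMr //.
by apply/ltW/MN/(leq_trans Nn)/leq_id_homo_ltn.
Qed.

(** The induction runs from the last coordinate, which is geometric, up to the
    first: each coordinate is driven by the one below it. *)
Lemma jordan_orbit_contracting (i : 'I_l.+1) :
  Num.archimedean_axiom K -> `|z| < 1 -> (fun n => (A ^+ n *m x) i ord0) @ \oo --> 0.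
Proof.
move=> aK z1; have [d] := ubnP (l - i); elim: d i => // d IH i id.
apply: (cvg0_affine_recurrence aK z1 (fun n => jordan_orbitS n i)).
case: insubP => [j jl jE|_]; last exact: cvg_cst.
apply: IH; rewrite jE; rewrite ltnS in jl.
by move: id; rewrite ltnS; apply: leq_trans; rewrite ltn_sub2l // jE.
Qed.

Lemma limit_set_contracting :
  Num.archimedean_axiom K -> `|z| < 1 -> limit_set A x = [set 0].
Proof.
move=> aK z1; have A0 k i : {homo k : m n / (m < n)%N} ->
    (fun n => (A ^+ k n *m x) i ord0) @ \oo --> 0.
  move=> kh; have koo : k @ \oo --> \oo.
    apply/cvgnyPge => N; exists N => // n /= Nn.
    by apply: leq_trans Nn _; exact: leq_id_homo_ltn.
  exact: (@cvg_comp _ _ _ k (fun n => (A ^+ n *m x) i ord0) _ _ _ koo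
    (jordan_orbit_contracting i aK z1)).
apply/seteqP; split=> [y /limit_setP[k [_ kh ky]]|_ ->].
  apply/matrixP => i j; rewrite ord1 mxE.
  exact: (cvg_unique _ (ky i) (A0 k i kh)).
by apply/limit_setP; exists S; split=> // i; rewrite mxE; exact: A0.
Qed.

End JordanOrbit.

(** * Recurrence of the powers of a unimodular complex number *)

(** Two terms close to the same cluster point are close to each other, and
    every neighbourhood of a cluster point is visited at arbitrarily late
    times. *)
Lemma compact_close_terms (R : numFieldType) (T : pseudoMetricType R) (C : set T)
    (u : nat -> T) (e : R) :
  compact C -> (forall n, C (u n)) -> 0 < e ->
  exists i j, (i < j)%N /\ ball (u i) e (u j).
Proof.
move=> cC uC e0.
have [c [_ cu]] : C `&` cluster (u @ \oo) !=set0.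
  by apply: cC; exists 0%N => // n _; exact: uC.
have e20 : 0 < e / 2 by rewrite divr_gt0.
have after N : exists2 n, (N < n)%N & ball c (e / 2) (u n).
  have [||_ [[n Nn <-] cn]] := cu (u @` [set n | (N < n)%N]) (ball c (e / 2)).
  - by exists N.+1 => // n /= Nn; exists n.
  - exact: nbhsx_ballx.
  by exists n.
have [i _ ci] := after 0%N; have [j ij cj] := after i.
by exists i, j; split=> //; apply: ball_splitr ci cj.
Qed.

Lemma complex_archimedean (R : realType) : Num.archimedean_axiom R[i].
Proof.
move=> z; exists (Num.bound (complex.Re `|z|)).
rewrite normc_def /=; set r := Num.sqrt _.
rewrite -(rmorph_nat (real_complex R)) ltcR.
by apply: archi_boundP; exact: sqrtr_ge0.
Qed.

Lemma complex_norm_lt (R : rcfType) (w : R[i]) (r : R) :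
  `|complex.Re w| < r -> `|complex.Im w| < r -> `|w| < (r + r)%:C.
Proof.
move=> a b; have r0 : 0 < r by exact: le_lt_trans a.
rewrite normc_def ltcR -[ltRHS]gtr0_norm ?addr_gt0 // -sqrtr_sqr ltr_sqrt.
  by move: a b; rewrite !ltr_norml => /andP[? ?] /andP[? ?]; nra.
by rewrite exprn_gt0 ?addr_gt0.
Qed.

(** Compactness is used in the real plane, through real and imaginary parts.
    It is applied to the powers of [z ^ (N + 1)] rather than of z, so that two
    distinct exponents automatically differ by more than N. *)
Lemma unimodular_recurrence (R : realType) (z e : R[i]) (N : nat) :
  `|z| = 1 -> 0 < e -> exists2 q, (N <= q)%N & `|1 - z ^+ q| < e.
Proof.
move=> z1 e0.
have [r r0 er] : exists2 r : R, 0 < r & e = (r + r)%:C.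
  move: e0; case: e => a b; rewrite ltcE /= => /andP[/eqP -> a0].
  by exists (a / 2); rewrite ?divr_gt0 // -splitr.
pose u n : R * R := (complex.Re (z ^+ (N.+1 * n)), complex.Im (z ^+ (N.+1 * n))).
have uC n : (`[(-1) : R, 1] `*` `[(-1) : R, 1]) (u n).
  have : complex.Re (z ^+ (N.+1 * n)) ^+ 2 + complex.Im (z ^+ (N.+1 * n)) ^+ 2 = 1.
    by apply: complexI; rewrite add_Re2_Im2 normrX z1 !expr1n.
  by split; rewrite /= in_itv /=; apply/andP; split; nra.
have [i [j [ij]]] := compact_close_terms
  (compact_setX (@segment_compact R _ _) (@segment_compact R _ _)) uC r0.
case=> /= uRe uIm; exists (N.+1 * (j - i))%N.
  by rewrite (leq_trans (leqnSn N)) // leq_pmulr // subn_gt0.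
have -> : `|1 - z ^+ (N.+1 * (j - i))| = `|z ^+ (N.+1 * i) - z ^+ (N.+1 * j)|.
  transitivity `|z ^+ (N.+1 * i) * (1 - z ^+ (N.+1 * (j - i)))|.
    by rewrite normrM normrX z1 expr1n mul1r.
  by rewrite mulrBr mulr1 -exprD -mulnDr subnKC // ltnW.
by rewrite er; apply: complex_norm_lt; rewrite raddfB.
Qed.

(** * Limit sets for unimodular eigenvalues *)

(** A point of the closure may be near a power z^n for one n only; multiplying
    by a power z^q near 1 moves the exponent arbitrarily far. *)
Lemma closure_pos_powers_frequently (K : numFieldType) (z d : K) :
  `|z| = 1 ->
  (forall (e : K) N, 0 < e -> exists2 q, (N <= q)%N & `|1 - z ^+ q| < e) ->
  closure_pos_powers z d ->
  forall (e : K) N, 0 < e -> exists2 n, (N <= n)%N & `|d - z ^+ n| < e.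
Proof.
move=> z1 zrec dD e N e0; have e20 : 0 < e / 2 by rewrite divr_gt0.
have [_ [[n _ <-] dn]] := dD _ (nbhsx_ballx d (e / 2) e20).
have [q Nq zq] := zrec (e / 2) N e20.
exists (n + q)%N; first exact: leq_trans (leq_addl _ _).
have -> : d - z ^+ (n + q) = (d - z ^+ n) + z ^+ n * (1 - z ^+ q).
  by rewrite exprD; ring.
apply: le_lt_trans (ler_normD _ _) _; rewrite [ltRHS]splitr.
by rewrite normrM normrX z1 expr1n mul1r ltrD.
Qed.

(** Recurrence of the powers of z is a hypothesis because it comes from local
    compactness, which a general numeric field does not have. *)
Lemma limit_set_unimodular (K : numFieldType) (l : nat) (z : K)
    (x : 'cV[K]_l.+1) :
  Num.archimedean_axiom K -> `|z| = 1 ->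
  (forall (e : K) N, 0 < e -> exists2 q, (N <= q)%N & `|1 - z ^+ q| < e) ->
  (forall i, i != ord0 -> x i ord0 = 0) ->
  limit_set (jordan_block l.+1 z) x =
    [set y : 'cV[K]_l.+1 | (exists2 d, closure_pos_powers z d
                              & y ord0 ord0 = d * x ord0 ord0) /\
                           forall i, i != ord0 -> y i ord0 = 0].
Proof.
move=> aK z1 zrec x0.
have x_above (j : 'I_l.+1) : ((ord0 : 'I_l.+1) < j)%N -> x j ord0 = 0.
  by rewrite lt0n => j0; apply: x0.
have orbit0 n := jordan_orbit_top z n x_above.
have orbit_above n i : i != ord0 -> (jordan_block l.+1 z ^+ n *m x) i ord0 = 0.
  by move=> i0; apply: jordan_orbit_above x_above _ _; rewrite lt0n.
apply/seteqP; split=> [y /limit_setP[k [k0 kh ky]]|y [[d dD yd] y0]].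
- have y0 i : i != ord0 -> y i ord0 = 0.
    move=> i0; have := ky i; under eq_fun do rewrite orbit_above //.
    by move/cvg_unique; apply; [exact: norm_hausdorff | exact: cvg_cst].
  split=> //; have := ky ord0; under eq_fun do rewrite orbit0.
  move=> {}ky.
  have [xeq0|xn0] := eqVneq (x ord0 ord0) 0.
    (* The limit is then 0, and any element of the closure can serve as d. *)
    exists z; first by apply: subset_closure; exists 1%N; rewrite ?expr1.
    move: ky; rewrite xeq0 mulr0; under eq_fun do rewrite mulr0.
    by move/cvg_unique; apply; [exact: norm_hausdorff | exact: cvg_cst].
  exists (y ord0 ord0 / x ord0 ord0); last by rewrite divfK.
  have kd : (fun n => z ^+ k n) @ \oo --> y ord0 ord0 / x ord0 ord0.
    have := cvgMr_tmp (b := (x ord0 ord0)^-1) ky.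
    by under eq_fun do rewrite mulfK //; apply.
  move=> B /kd[N _ NB]; exists (z ^+ k N); split; last by apply: NB => /=.
  by exists (k N) => //; exact: k0.
have [k [k0 kh kd]] := frequently_cvg_subseq aK
  (closure_pos_powers_frequently z1 zrec dD).
apply/limit_setP; exists k; split=> // i; have [->|i0] := eqVneq i ord0.
  by under eq_fun do rewrite orbit0; rewrite yd; exact: cvgMr_tmp.
under eq_fun do rewrite orbit_above //.
by rewrite y0 //; exact: cvg_cst.
Qed.

(** * The trichotomy *)

Theorem proposition2p1 (R : realType) (l : nat) (lambda : R[i]) :
  let A : 'M[R[i]]_l.+1 := jordan_block l.+1 lambda in
  let D : set R[i] := closure_pos_powers lambda in
  [/\ `|lambda| = 1 ->
        forall x : 'cV[R[i]]_l.+1,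
          (limit_set A x !=set0 <-> forall i, i != ord0 -> x i ord0 = 0) /\
          ((forall i, i != ord0 -> x i ord0 = 0) ->
           limit_set A x =
             [set y : 'cV[R[i]]_l.+1 | (exists2 d, D d
                          & y ord0 ord0 = d * x ord0 ord0) /\
                      forall i, i != ord0 -> y i ord0 = 0]),
      1 < `|lambda| ->
        forall x : 'cV[R[i]]_l.+1, x != 0 -> limit_set A x = set0
    & `|lambda| < 1 ->
        forall x : 'cV[R[i]]_l.+1, limit_set A x = [set 0]].
Proof.
have aC := @complex_archimedean R.
move=> A D; split=> [l1 x | l1 x x0 | l1 x].
- have lrec (e : R[i]) N := @unimodular_recurrence R lambda e N l1.
  split; last exact: limit_set_unimodular.
  split=> [[y xy]|x0]; first exact: limit_set_unimodular_support xy.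
  rewrite limit_set_unimodular //; exists (lambda *: x); split=> [|i i0].
    exists lambda; last by rewrite mxE.
    by apply: subset_closure; exists 1%N; rewrite ?expr1.
  by rewrite mxE x0 // mulr0.
- exact: limit_set_expanding.
- exact: limit_set_contracting.
Qed.
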